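(* Let $M_2$ be a timelike helicoidal surface of type II in $\mathbb{E}^n_1$ ($n\ge 3$), parametrized by $H_2(u,v)=(x_1(u)+cv,x_2(u),\dots,x_{n-2}(u),x_n(u)\sinh v,x_n(u)\cosh v)$ with $c>0$, and let $\alpha_2(t)=H_2(u(t),v(t))$, $t$ in an open interval, be a timelike loxodrome on $M_2$ with constant angle $\phi_0>0$ and with $\dot u(t)\ne0$ for all $t$. Then $\alpha_2$ can be parametrized by $u$, $\alpha_2(u)=H_2(u,v(u))$, where, for $u_0$ in the range of $u(t)$ and up to an additive constant in $v$ and with one fixed choice of sign, $v(u)$ is given by: (i) if the meridians are spacelike ($\varepsilon=1$), $$v(u)=\int_{u_0}^u\frac{-2c\cosh^2\phi_0\,x_1'(\xi)\pm\sqrt{\sinh^2(2\phi_0)\,(c^2(x_1'^2(\xi)-1)-x_n^2(\xi))}}{2\sinh^2\phi_0\,(x_n^2(\xi)+c^2)+2c^2x_1'^2(\xi)}\,d\xi;$$ (ii) if the meridians are timelike ($\varepsilon=-1$), $$v(u)=\int_{u_0}^u\frac{-2c\sinh^2\phi_0\,x_1'(\xi)\pm\sqrt{\sinh^2(2\phi_0)\,(x_n^2(\xi)+c^2(x_1'^2(\xi)+1))}}{2\cosh^2\phi_0\,(x_n^2(\xi)+c^2)+2c^2x_1'^2(\xi)}\,d\xi.$$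
   Context: $\mathbb{E}^n_1$ is $\mathbb{R}^n$ with the metric $\langle\cdot,\cdot\rangle$ given by $dx_1^2+\cdots+dx_{n-1}^2-dx_n^2$, and $\|w\|=\sqrt{|\langle w,w\rangle|}$. A vector $w$ is spacelike if $\langle w,w\rangle>0$ or $w=0$, timelike if $\langle w,w\rangle<0$; a curve is timelike if its velocity is timelike everywhere. Helicoidal surface of type II: let $I\subset\mathbb{R}$ be an open interval, $\beta(u)=(x_1(u),x_2(u),\dots,x_{n-2}(u),0,x_n(u))$, $u\in I$, a smooth regular curve parametrized by arc length, i.e. $x_1'^2+x_2'^2+\cdots+x_{n-2}'^2-x_n'^2=\varepsilon$ with $\varepsilon\in\{1,-1\}$ constant, and $c>0$ a constant. The surface is parametrized by $H_2$ ($u\in I$, $v\in\mathbb{R}$). It is timelike if $EG-F^2<0$ everywhere, where $E=\langle (H_2)_u,(H_2)_u\rangle$, $F=\langle (H_2)_u,(H_2)_v\rangle$, $G=\langle (H_2)_v,(H_2)_v\rangle$; equivalently $c^2(\varepsilon-x_1'^2(u))+\varepsilon x_n^2(u)<0$ for all $u$. The meridians are the curves $u\mapsto H_2(u,v_0)$ with $v_0$ constant; they are spacelike if $\varepsilon=1$ and timelike if $\varepsilon=-1$. Lorentzian angle: for $x$ nonzero spacelike and $y$ timelike, the angle is the unique $\theta\ge0$ with $\langle x,y\rangle=\pm\|x\|\|y\|\sinh\theta$; for $x,y$ both timelike, it is the unique $\theta\ge 0$ with $\langle x,y\rangle=\pm\|x\|\|y\|\cosh\theta$. A timelike loxodrome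 with constant angle $\phi_0$ is a smooth timelike curve $\alpha_2(t)=H_2(u(t),v(t))$ such that, for every $t$, the Lorentzian angle between $\dot\alpha_2(t)$ and the meridian tangent vector $(H_2)_u(u(t),v(t))$ equals $\phi_0$. *)

(* Defs.v *)
From mathcomp Require Import all_boot all_order all_algebra.
From mathcomp Require Import all_classical all_reals all_analysis.

Set Implicit Arguments.
Unset Strict Implicit.
Unset Printing Implicit Defensive.
Import Order.TTheory GRing.Theory Num.Theory.
Import numFieldNormedType.Exports.

Local Open Scope ring_scope.
Local Open Scope classical_set_scope.

Definition sinh (R : realType) (x : R) : R := (expR x - expR (- x)) / 2.
Definition cosh (R : realType) (x : R) : R := (expR x + expR (- x)) / 2.

Definition open_interval (R : realType) (I : set R) : Prop :=
  [/\ I !=set0, open I & is_interval I].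

(* C^oo on A; meant for open A, where the iterated derivatives at points of A
   do not depend on the values of f outside A. *)
Definition smooth_on (R : realType) (V : normedModType R) (A : set R)
    (f : R -> V) : Prop :=
  forall (k : nat) (t : R), A t -> derivable (derive1n k f) t 1.

(* The integral from a to b with the usual orientation: it changes sign when
   b < a. *)
Definition oriented_integral (R : realType) (f : R -> R) (a b : R) : R :=
  if a <= b then \int[lebesgue_measure]_(t in `[a, b]) f t
  else - \int[lebesgue_measure]_(t in `[b, a]) f t.

(* Coordinates of 'rV_n are numbered from 0, so the last one has i.+1 = n. *)
Definition lorentz (R : realType) (n : nat) (x y : 'rV[R]_n) : R :=
  \sum_(i < n) (if i.+1 == n then -1 else 1) * (x 0 i * y 0 i).

Definition lnorm (R : realType) (n : nat) (w : 'rV[R]_n) : R :=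
  Num.sqrt `|lorentz w w|.

Definition spacelike (R : realType) (n : nat) (w : 'rV[R]_n) : Prop :=
  0 < lorentz w w \/ w = 0.

Definition timelike (R : realType) (n : nat) (w : 'rV[R]_n) : Prop :=
  lorentz w w < 0.

Definition spacelike_curve (R : realType) (n : nat) (A : set R)
    (f : R -> 'rV[R]_n) : Prop :=
  forall t, A t -> spacelike (derive1 f t).

Definition timelike_curve (R : realType) (n : nat) (A : set R)
    (f : R -> 'rV[R]_n) : Prop :=
  forall t, A t -> timelike (derive1 f t).

(* [lorentz_angle x y theta] : theta is the Lorentzian angle between x and y,
   where y is timelike and x is either nonzero spacelike or timelike.  It is a
   relation, since the angle is not defined for all pairs of vectors; theta is
   unique because sinh and cosh are injective on [0, +oo[. *)
Definition lorentz_angle (R : realType) (n : nat) (x y : 'rV[R]_n) (theta : R)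
    : Prop :=
  0 <= theta /\
  ([/\ spacelike x, x != 0, timelike y &
       lorentz x y = lnorm x * lnorm y * sinh theta \/
       lorentz x y = - (lnorm x * lnorm y * sinh theta)] \/
   [/\ timelike x, timelike y &
       lorentz x y = lnorm x * lnorm y * cosh theta \/
       lorentz x y = - (lnorm x * lnorm y * cosh theta)]).

Definition partial_u (R : realType) (n : nat) (H : R -> R -> 'rV[R]_n)
    (u v : R) : 'rV[R]_n := derive1 (fun s => H s v) u.

Definition partial_v (R : realType) (n : nat) (H : R -> R -> 'rV[R]_n)
    (u v : R) : 'rV[R]_n := derive1 (fun s => H u s) v.

Definition timelike_surface (R : realType) (n : nat) (I : set R)
    (H : R -> R -> 'rV[R]_n) : Prop :=
  forall u v : R, I u ->
    let E := lorentz (partial_u H u v) (partial_u H u v) in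
    let F := lorentz (partial_u H u v) (partial_v H u v) in
    let G := lorentz (partial_v H u v) (partial_v H u v) in
    E * G - F ^+ 2 < 0.

Definition spacelike_meridians (R : realType) (n : nat) (I : set R)
    (H : R -> R -> 'rV[R]_n) : Prop :=
  forall v0 : R, spacelike_curve I (fun u => H u v0).

Definition timelike_meridians (R : realType) (n : nat) (I : set R)
    (H : R -> R -> 'rV[R]_n) : Prop :=
  forall v0 : R, timelike_curve I (fun u => H u v0).

(* The profile curve (x_1(u), ..., x_(n-2)(u), 0, x_n(u)).  The family x is
   indexed from 1, while coordinates of 'rV_n are numbered from 0; x_0, x_(n-1)
   and x_k for k > n are irrelevant. *)
Definition profile (R : realType) (n : nat) (x : nat -> R -> R) (u : R)
    : 'rV[R]_n :=
  \row_(j < n) if j.+1 == n.-1 then 0 else x j.+1 u.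

Definition H2 (R : realType) (n : nat) (c : R) (x : nat -> R -> R) (u v : R)
    : 'rV[R]_n :=
  \row_(j < n)
    if j.+1 == 1%N then x 1%N u + c * v
    else if j.+1 == n.-1 then x n u * sinh v
    else if j.+1 == n then x n u * cosh v
    else x j.+1 u.

(* The profile curve is smooth and parametrized by arc length, of causal
   character eps; a helicoidal surface of type II is then the patch H2 c x. *)
Definition type2_profile (R : realType) (n : nat) (I : set R)
    (x : nat -> R -> R) (eps : R) : Prop :=
  [/\ smooth_on I (profile n x),
      eps = 1 \/ eps = -1 &
      forall u, I u ->
        lorentz (derive1 (profile n x) u) (derive1 (profile n x) u) = eps].

(* The curve is t |-> H (u t) (v t); its angle is taken with the tangent
   vector of the meridian through each of its points. *)
Definition timelike_loxodrome (R : realType) (n : nat) (I T : set R)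
    (H : R -> R -> 'rV[R]_n) (u v : R -> R) (phi0 : R) : Prop :=
  [/\ smooth_on T u /\ smooth_on T v,
      forall t, T t -> I (u t),
      smooth_on T (fun t => H (u t) (v t)),
      timelike_curve T (fun t => H (u t) (v t)) &
      forall t, T t ->
        lorentz_angle (partial_u H (u t) (v t))
          (derive1 (fun s => H (u s) (v s)) t) phi0].

Definition integrand_spacelike (R : realType) (n : nat) (c : R)
    (x : nat -> R -> R) (phi0 sg xi : R) : R :=
  let dx1 := derive1 (x 1%N) xi in
  let xn := x n xi in
  (- 2 * c * cosh phi0 ^+ 2 * dx1
   + sg * Num.sqrt (sinh (2 * phi0) ^+ 2
                    * (c ^+ 2 * (dx1 ^+ 2 - 1) - xn ^+ 2)))
  / (2 * sinh phi0 ^+ 2 * (xn ^+ 2 + c ^+ 2) + 2 * c ^+ 2 * dx1 ^+ 2).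

Definition integrand_timelike (R : realType) (n : nat) (c : R)
    (x : nat -> R -> R) (phi0 sg xi : R) : R :=
  let dx1 := derive1 (x 1%N) xi in
  let xn := x n xi in
  (- 2 * c * sinh phi0 ^+ 2 * dx1
   + sg * Num.sqrt (sinh (2 * phi0) ^+ 2
                    * (xn ^+ 2 + c ^+ 2 * (dx1 ^+ 2 + 1))))
  / (2 * cosh phi0 ^+ 2 * (xn ^+ 2 + c ^+ 2) + 2 * c ^+ 2 * dx1 ^+ 2).

(* On J, w is a primitive of f sg for one sign sg in {1, -1}; the sign depends
   neither on the base point u0 nor on the point s. *)
Definition given_by_integral (R : realType) (J : set R) (f : R -> R -> R)
    (w : R -> R) : Prop :=
  exists sg : R, (sg = 1 \/ sg = -1) /\
    forall u0, J u0 -> exists k : R, forall s, J s ->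
      w s = k + oriented_integral (f sg) u0 s.

(* Main.v *)
(* On H2 the first fundamental form is E = eps, F = c x_1', G = c^2 + x_n^2, and
   the slope p = dv/du of the curve has constant angle phi0 with the meridians
   exactly when (eps + F p)^2 = - (eps + 2 F p + G p^2) K, where K is
   sinh^2 phi0 if eps = 1 and cosh^2 phi0 if eps = -1.  The two roots of this
   quadratic are the two integrands.  Its discriminant is a positive multiple of
   F^2 - eps G, which is positive because the surface is timelike, so the slope
   stays on one of the roots. *)

Require Import Defs.
From mathcomp Require Import all_boot all_order all_algebra.
From mathcomp Require Import all_classical all_reals all_analysis.
From mathcomp Require Import zify ring lra.
Import Order.TTheory GRing.Theory Num.Theory.
Import numFieldNormedType.Exports.
Local Open Scope ring_scope.
Local Open Scope classical_set_scope.

Set Implicit Arguments.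
Unset Strict Implicit.
Unset Printing Implicit Defensive.

(** * Calculus of functions differentiable to a finite order on an open set *)

(** Bounding the order of differentiation allows induction on it: the derivative of a product,
    inverse or composite involves the original functions again, but at a lower order. *)
Definition derivable_upto (R : realType) (k : nat) (A : set R) (f : R -> R) :=
  forall j, (j <= k)%N -> forall t, A t -> derivable (derive1n j f) t 1.

Lemma smooth_on_upto (R : realType) (A : set R) (f : R -> R) :
  smooth_on A f <-> forall k, derivable_upto k A f.
Proof.
split=> [sf k j _ t|sf k t]; first exact: sf.
exact: sf.
Qed.

Lemma smooth_on_derivable (R : realType) (A : set R) (f : R -> R) t :
  smooth_on A f -> A t -> derivable f t 1.
Proof. by move=> sf At; exact: (sf 0%N). Qed.

Lemma smooth_on_derive1 (R : realType) (A : set R) (f : R -> R) :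
  smooth_on A f -> smooth_on A (derive1 f).
Proof. by move=> sf k t At; rewrite -derive1Sn; exact: sf. Qed.

Lemma derivable_uptoW (R : realType) k (A : set R) (f : R -> R) :
  derivable_upto k.+1 A f -> derivable_upto k A f.
Proof. by move=> sf j jk; apply: sf; rewrite leqW. Qed.

Lemma derivable_upto0 (R : realType) (A : set R) (f : R -> R) :
  (forall t, A t -> derivable f t 1) -> derivable_upto 0 A f.
Proof. by move=> df j; rewrite leqn0 => /eqP ->. Qed.

Lemma derivable_uptoS (R : realType) k (A : set R) (f : R -> R) :
  (forall t, A t -> derivable f t 1) -> derivable_upto k A (derive1 f) ->
  derivable_upto k.+1 A f.
Proof.
by move=> df df' [_|j jk] t At; rewrite ?derive1Sn; [exact: df|exact: df'].
Qed.

Lemma derivable_uptoD1 (R : realType) k (A : set R) (f : R -> R) :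
  derivable_upto k.+1 A f -> derivable_upto k A (derive1 f).
Proof. by move=> sf j jk t At; rewrite -derive1Sn; exact: sf. Qed.

Lemma derivable_upto_derivable (R : realType) k (A : set R) (f : R -> R) t :
  derivable_upto k A f -> A t -> derivable f t 1.
Proof. by move=> sf; exact: (sf 0%N). Qed.

Lemma derive1_eq_on (R : realType) (A : set R) (f g : R -> R) :
  open A -> {in A, f =1 g} -> {in A, derive1 f =1 derive1 g}.
Proof.
move=> oA fg t /set_mem At; rewrite !derive1E; apply: near_eq_derive.
apply: filterS (open_nbhs_nbhs (conj oA At)) => s As.
by apply: fg; rewrite inE.
Qed.

Lemma derivable_upto_eq (R : realType) k (A : set R) (f g : R -> R) :
  open A -> {in A, f =1 g} -> derivable_upto k A f -> derivable_upto k A g.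
Proof.
move=> oA fg sf j jk t At.
have fgj : {in A, derive1n j f =1 derive1n j g}.
  by elim: j {jk} => [|j IHj]; [exact: fg|exact: derive1_eq_on IHj].
apply: near_eq_derivable (sf j jk t At).
apply: filterS (open_nbhs_nbhs (conj oA At)) => s As.
by apply: fgj; rewrite inE.
Qed.

(** The induction step of the closure lemmas below. A formula for the derivative valid only on [A]
    is enough, since on an open set iterated derivatives depend only on the values there. *)
Lemma derivable_upto_is_derive (R : realType) k (A : set R) (f f' : R -> R) :
  open A -> (forall t, A t -> is_derive t 1 f (f' t)) ->
  derivable_upto k A f' -> derivable_upto k.+1 A f.
Proof.
move=> oA df sf'; apply: derivable_uptoS => [t At|].
  by have [] := df t At.
apply: (derivable_upto_eq oA _ sf') => t /set_mem At.
by rewrite derive1E; have [_ ->] := df t At.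
Qed.

Lemma derivable_is_derive (R : realType) (f : R -> R) t :
  derivable f t 1 -> is_derive t 1 f (derive1 f t).
Proof. by move=> df; rewrite derive1E; exact: derivableP. Qed.

Lemma derivable_upto_cst (R : realType) k (A : set R) (a : R) :
  derivable_upto k A (fun=> a).
Proof.
elim: k a => [|k IHk] a.
  by apply: derivable_upto0 => t _; exact: derivable_cst.
apply: derivable_uptoS => [t _|]; first exact: derivable_cst.
have -> : derive1 (fun=> a) = (fun=> 0 : R).
  by apply/funext => t; exact: derive1_cst.
exact: IHk.
Qed.

Lemma derivable_uptoD (R : realType) k (A : set R) (f g : R -> R) : open A ->
  derivable_upto k A f -> derivable_upto k A g ->
  derivable_upto k A (fun t => f t + g t).
Proof.
move=> oA; elim: k f g => [|k IHk] f g sf sg.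
  apply: derivable_upto0 => t At.
  by apply: derivableD; [exact: derivable_upto_derivable sf At
                        |exact: derivable_upto_derivable sg At].
apply: (derivable_upto_is_derive
  (f' := fun t => derive1 f t + derive1 g t) oA) => [t At|].
  apply: is_deriveD; apply: derivable_is_derive.
    exact: derivable_upto_derivable sf At.
  exact: derivable_upto_derivable sg At.
exact: (IHk _ _ (derivable_uptoD1 sf) (derivable_uptoD1 sg)).
Qed.

Lemma derivable_uptoM (R : realType) k (A : set R) (f g : R -> R) : open A ->
  derivable_upto k A f -> derivable_upto k A g ->
  derivable_upto k A (fun t => f t * g t).
Proof.
move=> oA; elim: k f g => [|k IHk] f g sf sg.
  apply: derivable_upto0 => t At.
  by apply: derivableM; [exact: derivable_upto_derivable sf At
                        |exact: derivable_upto_derivable sg At].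
apply: (derivable_upto_is_derive
  (f' := fun t => f t * derive1 g t + g t * derive1 f t) oA) => [t At|].
  apply: is_deriveM; apply: derivable_is_derive.
    exact: derivable_upto_derivable sf At.
  exact: derivable_upto_derivable sg At.
have [sf' sg'] := (derivable_uptoD1 sf, derivable_uptoD1 sg).
have [sf0 sg0] := (derivable_uptoW sf, derivable_uptoW sg).
exact: (derivable_uptoD oA (IHk _ _ sf0 sg') (IHk _ _ sg0 sf')).
Qed.

Lemma derivable_uptoV (R : realType) k (A : set R) (f : R -> R) : open A ->
  (forall t, A t -> f t != 0) -> derivable_upto k A f ->
  derivable_upto k A (fun t => (f t)^-1).
Proof.
move=> oA f0; elim: k f f0 => [|k IHk] f f0 sf.
  apply: derivable_upto0 => t At.
  by apply: derivableV; [exact: f0|exact: derivable_upto_derivable sf At].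
apply: (derivable_upto_is_derive
  (f' := fun t => (- 1) * ((f t)^-1 * (f t)^-1) * derive1 f t) oA) => [t At|].
  have df := derivable_is_derive (derivable_upto_derivable sf At).
  have := is_deriveV (f0 t At) df.
  by rewrite /GRing.scale/= mulN1r -exprVn expr2.
have sV : derivable_upto k A (fun t => (f t)^-1).
  exact: (IHk _ f0 (derivable_uptoW sf)).
apply: (derivable_uptoM oA _ (derivable_uptoD1 sf)).
exact: (derivable_uptoM oA (@derivable_upto_cst R k A (-1))
  (derivable_uptoM oA sV sV)).
Qed.

(** The outer function is fully smooth, so the induction can pass from [g] to its derivative, while
    the inner one has order [k] only. This asymmetry is what [smooth_inverse] needs, where the inner
    function is the inverse whose regularity is being raised. *)
Lemma derivable_upto_comp (R : realType) k (A B : set R) (f g : R -> R) :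
  open A -> (forall t, A t -> B (f t)) ->
  derivable_upto k A f -> smooth_on B g ->
  derivable_upto k A (fun t => g (f t)).
Proof.
move=> oA fAB; elim: k g => [|k IHk] g sf sg.
  apply: derivable_upto0 => t At.
  have df := derivable_is_derive (derivable_upto_derivable sf At).
  have dg := derivable_is_derive (smooth_on_derivable sg (fAB t At)).
  by have [] := is_derive1_comp dg df.
apply: (derivable_upto_is_derive (f := fun t => g (f t))
  (f' := fun t => derive1 g (f t) * derive1 f t) oA) => [t At|].
  have df := derivable_is_derive (derivable_upto_derivable sf At).
  have dg := derivable_is_derive (smooth_on_derivable sg (fAB t At)).
  exact: is_derive1_comp dg df.
apply: (derivable_uptoM oA _ (derivable_uptoD1 sf)).
exact: (IHk _ (derivable_uptoW sf) (smooth_on_derive1 sg)).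
Qed.

Lemma smooth_on_comp (R : realType) (A B : set R) (f g : R -> R) :
  open A -> (forall t, A t -> B (f t)) -> smooth_on A f -> smooth_on B g ->
  smooth_on A (fun t => g (f t)).
Proof.
move=> oA fAB /smooth_on_upto sf sg; apply/smooth_on_upto => k.
exact: derivable_upto_comp fAB (sf k) sg.
Qed.

Lemma smooth_onV (R : realType) (A : set R) (f : R -> R) :
  open A -> (forall t, A t -> f t != 0) -> smooth_on A f ->
  smooth_on A (fun t => (f t)^-1).
Proof.
move=> oA f0 /smooth_on_upto sf; apply/smooth_on_upto => k.
exact: derivable_uptoV (sf k).
Qed.

(** * Injectivity and smooth inverses on an interval *)

Lemma derivable1_continuous (R : realType) (f : R -> R) t :
  derivable f t 1 -> {for t, continuous f}.
Proof. by move/derivable1_diffP; exact: differentiable_continuous. Qed.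

Lemma interval_itv_sub (R : realType) (A : set R) a b :
  is_interval A -> A a -> A b -> `[a, b] `<=` A.
Proof.
move=> iA Aa Ab t /=; rewrite in_itv/= => atb; exact: iA atb.
Qed.

Lemma continuous_on_within (R : realType) (A : set R) (f : R -> R) a b :
  is_interval A -> A a -> A b -> (forall t, A t -> {for t, continuous f}) ->
  {within `[a, b], continuous f}.
Proof.
move=> iA Aa Ab cf; apply: continuous_in_subspaceT => t /set_mem tab.
by apply: cf; exact: interval_itv_sub tab.
Qed.

(** By Rolle, two distinct points with equal values would enclose a zero of the derivative. *)
Lemma derive1_neq0_inj (R : realType) (A : set R) (f : R -> R) :
  is_interval A -> (forall t, A t -> derivable f t 1) ->
  (forall t, A t -> derive1 f t != 0) ->
  forall s t, A s -> A t -> f s = f t -> s = t.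
Proof.
move=> iA df f'0.
have main s t : A s -> A t -> f s = f t -> ~ s < t.
  move=> As At fst slt.
  have sub := interval_itv_sub iA As At.
  have [|||r rst [_ f'r]] := @Rolle _ f s t slt.
  - by move=> r rst; apply: df; apply: sub; exact: subset_itv_oo_cc.
  - by apply: continuous_on_within iA As At _ => r Ar;
      exact/derivable1_continuous/df.
  - exact: fst.
  have /f'0 : A r by apply: sub; exact: subset_itv_oo_cc.
  by rewrite derive1E f'r eqxx.
move=> s t As At fst; have [lt|lt|//] := ltgtP s t.
  by have := main s t As At fst.
by have := main t s At As (esym fst).
Qed.

(* The inverse tau satisfies tau' = (1 / f') o tau, so each derivative of tau
   yields the next one. *)
Lemma smooth_inverse (R : realType) (A : set R) (f : R -> R) :
  open_interval A -> smooth_on A f -> (forall t, A t -> derive1 f t != 0) ->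
  exists tau : R -> R, [/\ open_interval (f @` A),
    forall t, A t -> tau (f t) = t, smooth_on (f @` A) tau &
    forall s, (f @` A) s -> is_derive s 1 tau (derive1 f (tau s))^-1].
Proof.
move=> [[t0 At0] oA iA] sf f'0.
have df t : A t -> derivable f t 1 := @smooth_on_derivable _ _ _ t sf.
have finj := derive1_neq0_inj iA df f'0.
(* A chosen preimage, unique by injectivity; off the image of [f] the value is the default [t0]. *)
pose tau s := xget t0 [set t | A t /\ f t = s].
have tauK t : A t -> tau (f t) = t.
  move=> At; rewrite /tau; case: xgetP => [r _ [Ar]|/(_ t) []//].
  exact: finj.
have cf t : A t -> {for t, continuous f}.
  by move=> At; exact/derivable1_continuous/df.
have nearA t : A t -> \near t, A t.
  by move=> At; apply: open_nbhs_nbhs.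
have ncf t : A t -> {near t, continuous f}.
  by move=> At; apply: filterS (nearA t At) => r; exact: cf.
have nK t : A t -> {near t, cancel f tau}.
  by move=> At; apply: filterS (nearA t At) => r; exact: tauK.
have dtau s : (f @` A) s -> is_derive s 1 tau (derive1 f (tau s))^-1.
  move=> [t At <-]; rewrite tauK//.
  apply: is_derive_inverse; [exact: nK|exact: ncf| |exact: f'0].
  exact/derivable_is_derive/df.
have tauA s : (f @` A) s -> A (tau s) by move=> [t At <-]; rewrite tauK.
(* Near [f t] the local inverse stays in [A] by continuity and satisfies [f (tau r) = r], so every
   nearby [r] is an image. *)
have oJ : open (f @` A).
  rewrite openE => s [t At <-].
  have ctau : {for f t, continuous tau}.
    apply: derivable1_continuous.
    by have [] := dtau (f t) (ex_intro2 _ _ t At erefl).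
  have Ktau : {near f t, cancel tau f}.
    by apply: near_continuous_can_sym; [exact: ncf|exact: nK].
  have nA : \forall s \near f t, A (tau s).
    by apply: ctau; rewrite tauK//; exact: nearA.
  rewrite /interior/=; near=> r; exists (tau r); first by near: r.
  by near: r; exact: Ktau.
have iJ : is_interval (f @` A).
  apply/connected_intervalP/connected_continuous_connected.
    exact/connected_intervalP.
  by apply: continuous_in_subspaceT => t /set_mem; exact: cf.
exists tau; split => //; first by split=> //; exists (f t0); exists t0.
have sV : smooth_on A (fun t => (derive1 f t)^-1).
  exact: (smooth_onV oA f'0 (smooth_on_derive1 sf)).
apply/smooth_on_upto; elim=> [|k IHk].
  by apply: derivable_upto0 => s Js; have [] := dtau s Js.
apply: (derivable_upto_is_derive oJ dtau).
exact: derivable_upto_comp tauA IHk sV.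
Unshelve. all: by end_near. Qed.

(** * Oriented integrals of derivatives and constancy of sign *)

Lemma Rintegral_derive1 (R : realType) (J : set R) (w : R -> R) a b :
  is_interval J -> (forall s, J s -> derivable w s 1) ->
  (forall s, J s -> {for s, continuous (derive1 w)}) ->
  J a -> J b -> a <= b ->
  \int[lebesgue_measure]_(s in `[a, b]) derive1 w s = w b - w a.
Proof.
(* The fundamental theorem is applied on a nondegenerate interval, so equal endpoints are treated
   apart. *)
move=> iJ dw cw' Ja Jb; rewrite le_eqVlt => /predU1P[->|ab].
  by rewrite set_itv1 Rintegral_set1 subrr.
have cw s : J s -> {for s, continuous w}.
  by move=> Js; exact/derivable1_continuous/dw.
rewrite /Rintegral (@continuous_FTC2 _ _ w)//.
- exact: continuous_on_within iJ Ja Jb cw'.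
- split.
  + move=> s sab; apply: dw; apply: (interval_itv_sub iJ Ja Jb).
    exact: subset_itv_oo_cc.
  + by apply: cvg_at_right_filter; exact: cw.
  + by apply: cvg_at_left_filter; exact: cw.
Qed.

Lemma oriented_integral_derive1 (R : realType) (J : set R) (f w : R -> R) a b :
  is_interval J -> (forall s, J s -> derivable w s 1) ->
  (forall s, J s -> {for s, continuous (derive1 w)}) ->
  {in J, derive1 w =1 f} ->
  J a -> J b -> w b = w a + oriented_integral f a b.
Proof.
move=> iJ dw cw' w'f.
have main c d : J c -> J d -> c <= d ->
    \int[lebesgue_measure]_(s in `[c, d]) f s = w d - w c.
  move=> Jc Jd cd; rewrite -(Rintegral_derive1 iJ dw cw' Jc Jd cd).
  apply: eq_Rintegral => s /set_mem scd; rewrite w'f// inE.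
  exact: interval_itv_sub iJ Jc Jd _ scd.
move=> Ja Jb; rewrite /oriented_integral; case: ifPn => [ab|].
  by rewrite main// addrC subrK.
by rewrite -ltNge => /ltW ba; rewrite main// opprB addrC subrK.
Qed.

(** By the intermediate value theorem a change of sign would force a zero, so the sign at one base
    point serves for all of [J]. *)
Lemma continuous_neq0_sign (R : realType) (J : set R) (g : R -> R) :
  is_interval J -> (forall s, J s -> {for s, continuous g}) ->
  (forall s, J s -> g s != 0) ->
  exists sg, (sg = 1 \/ sg = -1) /\ forall s, J s -> g s = sg * `|g s|.
Proof.
move=> iJ cg g0.
have same a b : J a -> J b -> a <= b -> 0 < g a * g b.
  move=> Ja Jb ab; rewrite ltNge; apply/negP => gab.
  have [||r rab gr0] := @IVT _ g a b 0 ab.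
  - exact: continuous_on_within iJ Ja Jb cg.
  (* A nonpositive product puts 0 between the two values. *)
  - have [ga|ga] := leP (g a) (g b); nra.
  have := g0 r (interval_itv_sub iJ Ja Jb rab).
  by rewrite gr0 eqxx.
have [[s0 Js0]|J0] := pselect (J !=set0); last first.
  by exists 1; split; [left|move=> s Js; case: J0; exists s].
exists (Num.sg (g s0)); split.
  case: (sgrP (g s0)) => [g00| |]; [|by left|by right].
  by move: (g0 _ Js0); rewrite g00 eqxx.
move=> s Js; have gg : 0 < g s0 * g s.
  by have [le|/ltW le] := leP s0 s; [exact: same|rewrite mulrC; exact: same].
have sgE : Num.sg (g s0) = Num.sg (g s).
  apply/eqP; move: (gtr0_sg gg); rewrite sgrM => sg1.
  move: (numEsg (g s)).
  by case: (sgrP (g s0)) sg1 => _; case: (sgrP (g s)) => _ //;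
    rewrite ?mulr0 ?mul0r ?mulN1r ?mul1r ?mulr1 => /eqP; rewrite ?eqxx//; lra.
by rewrite sgE -numEsg.
Qed.

(* The radicand is nowhere zero, so by continuity the sign with which its root
   enters w' cannot change along J. *)
Lemma given_by_integral_quadratic (R : realType) (J : set R)
    (f : R -> R -> R) (w a b d : R -> R) :
  is_interval J -> (forall s, J s -> derivable w s 1) ->
  (forall s, J s -> {for s, continuous (derive1 w)}) ->
  (forall s, J s -> {for s, continuous a}) ->
  (forall s, J s -> {for s, continuous b}) ->
  (forall s, J s -> 0 < b s) -> (forall s, J s -> 0 < d s) ->
  (forall sg s, J s -> f sg s = (a s + sg * Num.sqrt (d s)) / b s) ->
  (forall s, J s -> (derive1 w s * b s - a s) ^+ 2 = d s) ->
  given_by_integral J f w.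
Proof.
move=> iJ dw cw' ca cb b0 d0 fE w'E.
(* This is the square root of [d] taken with its sign. *)
pose g s := derive1 w s * b s - a s.
have absg s : J s -> `|g s| = Num.sqrt (d s).
  by move=> Js; rewrite -w'E// sqrtr_sqr.
have [||sg [sg1 gE]] := @continuous_neq0_sign _ J g iJ.
- move=> s Js; apply: continuousB; last exact: ca.
  by apply: continuousM; [exact: cw'|exact: cb].
- by move=> s Js; rewrite -normr_gt0 absg// sqrtr_gt0 d0.
(* The sign is fixed before the base point; the additive constant is the value of [w] at [u0]. *)
exists sg; split => // u0 Ju0; exists (w u0) => s Js.
apply: (oriented_integral_derive1 iJ dw cw') => // r /set_mem Jr.
rewrite fE// -absg// -gE// /g addrC subrK mulfK//.
by rewrite gt_eqF// b0.
Qed.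

(** * Hyperbolic functions *)

Lemma cosh2E (R : realType) (t : R) : cosh t ^+ 2 = 1 + sinh t ^+ 2.
Proof. by rewrite /cosh /sinh expRN; field; rewrite gt_eqF// expR_gt0. Qed.

Lemma sinh_double (R : realType) (t : R) : sinh (2 * t) = 2 * sinh t * cosh t.
Proof.
rewrite /cosh /sinh !expRN (_ : 2 * t = t + t); last by ring.
by rewrite expRD; field; rewrite gt_eqF// expR_gt0.
Qed.

Lemma sinh_gt0 (R : realType) (t : R) : 0 < t -> 0 < sinh t.
Proof.
by move=> t0; rewrite /sinh divr_gt0// subr_gt0 ltr_expR; lra.
Qed.

Lemma cosh_gt0 (R : realType) (t : R) : 0 < cosh t.
Proof. by rewrite /cosh divr_gt0// addr_gt0// expR_gt0. Qed.

Lemma is_derive_sinh (R : realType) (t : R) : is_derive t 1 (@sinh R) (cosh t).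
Proof.
apply: is_derive_eq; rewrite /cosh/= /GRing.scale/=; ring.
Qed.

Lemma is_derive_cosh (R : realType) (t : R) : is_derive t 1 (@cosh R) (sinh t).
Proof.
apply: is_derive_eq; rewrite /sinh/= /GRing.scale/=; ring.
Qed.

(** * Derivatives of row vectors and tangent vectors of [H2] *)

Lemma is_derive_row (R : realType) (n : nat) (f : R -> 'rV[R]_n) (d : 'rV[R]_n)
    (t : R) :
  (forall j, is_derive t 1 (fun s => f s 0 j) (d 0 j)) -> is_derive t 1 f d.
Proof.
move=> fd; have df : derivable f t 1.
  by apply/derivable_mxP => i j; rewrite ord1; have [] := fd j.
apply: DeriveDef => //; rewrite derive_mx//; apply/rowP => j; rewrite mxE.
by have [_ ->] := fd j.
Qed.

Lemma is_derive_derive1 (R : realType) (V : normedModType R) (f : R -> V) d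
    (t : R) :
  is_derive t 1 f d -> derive1 f t = d.
Proof. by move=> [_ <-]; rewrite derive1E. Qed.

Definition dprofile (R : realType) (n : nat) (x : nat -> R -> R) (u : R)
    : 'rV[R]_n :=
  \row_(j < n) if j.+1 == n.-1 then 0 else derive1 (x j.+1) u.

Definition H2u (R : realType) (n : nat) (x : nat -> R -> R) (u v : R)
    : 'rV[R]_n :=
  \row_(j < n)
    if j.+1 == 1%N then derive1 (x 1%N) u
    else if j.+1 == n.-1 then derive1 (x n) u * sinh v
    else if j.+1 == n then derive1 (x n) u * cosh v
    else derive1 (x j.+1) u.

Definition H2v (R : realType) (n : nat) (c : R) (x : nat -> R -> R) (u v : R)
    : 'rV[R]_n :=
  \row_(j < n)
    if j.+1 == 1%N then c
    else if j.+1 == n.-1 then x n u * cosh v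
    else if j.+1 == n then x n u * sinh v
    else 0.

(** Stated along an arbitrary parameter curve, so that it gives both partial derivatives (one
    parameter the identity, the other constant) as well as the velocity of the loxodrome. *)
Lemma is_derive_H2 (R : realType) (n : nat) (c : R) (x : nat -> R -> R)
    (u v : R -> R) (t du dv : R) : (3 <= n)%N ->
  (forall j, (0 < j <= n)%N -> j != n.-1 -> derivable (x j) (u t) 1) ->
  is_derive t 1 u du -> is_derive t 1 v dv ->
  is_derive t 1 (fun s => H2 n c x (u s) (v s))
    (du *: H2u n x (u t) (v t) + dv *: H2v n c x (u t) (v t)).
Proof.
move=> n3 dx uD vD; apply: is_derive_row => j; rewrite !mxE.
have dxu k : (0 < k <= n)%N -> k != n.-1 ->
    is_derive t 1 (fun s => x k (u s)) (derive1 (x k) (u t) * du).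
  move=> k0 kn; have := derivable_is_derive (dx k k0 kn).
  by move=> dxk; exact: (is_derive1_comp dxk uD).
have sv : is_derive t 1 (fun s => sinh (v s)) (cosh (v t) * dv).
  exact: (is_derive1_comp (is_derive_sinh (v t)) vD).
have cv : is_derive t 1 (fun s => cosh (v s)) (sinh (v t) * dv).
  exact: (is_derive1_comp (is_derive_cosh (v t)) vD).
have jn := ltn_ord j.
(* The case distinction depends on [j] alone; pulled out of the function, it leaves one
   differentiable expression per branch. *)
have -> : (fun s => H2 n c x (u s) (v s) 0 j) =
  if j.+1 == 1%N then fun s => x 1%N (u s) + c * v s
  else if j.+1 == n.-1 then fun s => x n (u s) * sinh (v s)
  else if j.+1 == n then fun s => x n (u s) * cosh (v s)
  else fun s => x j.+1 (u s).
  by apply/funext => s; rewrite mxE; do !case: ifP.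
have nn : n != n.-1 by lia.
case: ifPn => [j1|j1].
  have d1 : is_derive t 1 (fun s => x 1%N (u s)) (derive1 (x 1%N) (u t) * du).
    by apply: dxu; lia.
  have := is_deriveD d1 (is_deriveZ c vD).
  by rewrite /GRing.scale/= [du * _]mulrC [dv * _]mulrC.
case: ifPn => [jn1|jn1].
  have dn : is_derive t 1 (fun s => x n (u s)) (derive1 (x n) (u t) * du).
    by apply: dxu; lia.
  apply: (is_derive_eq (is_deriveM dn sv)); rewrite /GRing.scale/=; ring.
case: ifPn => [jn2|jn2].
  have dn : is_derive t 1 (fun s => x n (u s)) (derive1 (x n) (u t) * du).
    by apply: dxu; lia.
  apply: (is_derive_eq (is_deriveM dn cv)); rewrite /GRing.scale/=; ring.
rewrite mulr0 addr0 mulrC; apply: dxu => //.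
Qed.

(** * The Lorentz product and the first fundamental form *)

(** Isolates the first and the last two coordinates, which [H2] treats specially; the [m] middle
    ones stay in the sum. *)
Lemma lorentzE (R : realType) (m : nat) (y z : 'rV[R]_m.+3) :
  lorentz y z = y 0 ord0 * z 0 ord0
    + \sum_(i < m) y 0 (lift ord0 (widen_ord (leqnSn _) (widen_ord (leqnSn _) i)))
                   * z 0 (lift ord0 (widen_ord (leqnSn _) (widen_ord (leqnSn _) i)))
    + y 0 (lift ord0 (widen_ord (leqnSn _) ord_max))
      * z 0 (lift ord0 (widen_ord (leqnSn _) ord_max))
    - y 0 ord_max * z 0 ord_max.
Proof.
rewrite /lorentz big_ord_recl !big_ord_recr/= !mul1r.
rewrite /bump/= !add1n !eqSS eqxx (ltn_eqF (ltnSn m)) mulN1r mul1r.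
have -> : lift ord0 (@ord_max m.+1) = ord_max by apply: val_inj.
rewrite !addrA; do 3 congr (_ + _).
apply: eq_bigr => i _; rewrite /bump/= !add1n !eqSS ltn_eqF ?mul1r//.
by rewrite ltnW// ltnS ltn_ord.
Qed.

Lemma lorentzDZl (R : realType) (n : nat) (a b : R) (y z t : 'rV[R]_n) :
  lorentz (a *: y + b *: z) t = a * lorentz y t + b * lorentz z t.
Proof.
rewrite /lorentz !mulr_sumr -big_split/=; apply: eq_bigr => i _.
by rewrite !mxE; ring.
Qed.

Lemma lorentzC (R : realType) (n : nat) (y z : 'rV[R]_n) :
  lorentz y z = lorentz z y.
Proof. by apply: eq_bigr => i _; rewrite [y 0 i * _]mulrC. Qed.

(** The variable [v] acts by a Lorentz boost in the last two coordinates. By cosh^2 - sinh^2 = 1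
    their contributions are - x_n'^2 to E, 0 to F and x_n^2 to G, so none of the three depends on
    [v]. *)
Lemma first_fundamental_form (R : realType) (n : nat) (c : R)
    (x : nat -> R -> R) (u v : R) : (3 <= n)%N ->
  [/\ lorentz (H2u n x u v) (H2u n x u v)
        = lorentz (dprofile n x u) (dprofile n x u),
      lorentz (H2u n x u v) (H2v n c x u v) = c * derive1 (x 1%N) u &
      lorentz (H2v n c x u v) (H2v n c x u v) = c ^+ 2 + x n u ^+ 2].
Proof.
case: n => [|[|[|m]]]// _.
have mid i : (i < m)%N ->
    ((i.+1.+1 == m.+2) = false) * ((i.+1.+1 == m.+3) = false).
  by move=> im; split; apply/eqP; lia.
have m23 : (m.+3 == m.+2) = false by apply/eqP; lia.
have m32 : (m.+2 == m.+3) = false by apply/eqP; lia.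
have ch := cosh2E v.
split; rewrite !lorentzE !mxE/= ?/bump/= ?add1n ?eqxx ?m23 ?m32 ?eqSS/=.
- under eq_bigr => i _ do rewrite !mxE/= /bump/= add1n !mid ?ltn_ord//.
  under [in RHS]eq_bigr => i _ do rewrite !mxE/= /bump/= add1n !mid ?ltn_ord//.
  have -> (a : R) : a * sinh v * (a * sinh v) = a ^+ 2 * (cosh v ^+ 2 - 1).
    by rewrite ch; ring.
  ring.
- rewrite big1 => [|i _]; last first.
    by rewrite !mxE/= /bump/= add1n !mid ?ltn_ord// mulr0.
  ring.
- rewrite big1 => [|i _]; last first.
    by rewrite !mxE/= /bump/= add1n !mid ?ltn_ord// mulr0.
  ring: ch.
Qed.

(** * The angle condition as a quadratic equation for the slope *)

(** Squaring removes the sign ambiguity of the angle; as [z] is timelike, the square of its norm is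
    [- lorentz z z]. *)
Lemma lorentz_angle_spacelike (R : realType) (n : nat) (y z : 'rV[R]_n) theta :
  lorentz y y = 1 -> lorentz_angle y z theta ->
  lorentz y z ^+ 2 = - lorentz z z * sinh theta ^+ 2.
Proof.
move=> y1 [_ [[_ _ zt yz]|[yt _ _]]]; last first.
  by move: yt; rewrite /timelike y1; lra.
have -> : lorentz y z ^+ 2 = (lnorm y * lnorm z * sinh theta) ^+ 2.
  by case: yz => ->; rewrite ?sqrrN.
rewrite !exprMn /lnorm y1 !sqr_sqrtr ?normr_ge0// normr1 mul1r.
by rewrite ltr0_norm.
Qed.

Lemma lorentz_angle_timelike (R : realType) (n : nat) (y z : 'rV[R]_n) theta :
  lorentz y y = -1 -> lorentz_angle y z theta ->
  lorentz y z ^+ 2 = - lorentz z z * cosh theta ^+ 2.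
Proof.
(* The spacelike alternative is void: the product of [y] with itself is negative, and the zero
   vector is excluded. *)
move=> y1 [_ [[[y0|y0] yn0 _ _]|[_ zt yz]]]; first by move: y0; rewrite y1; lra.
  by rewrite y0 eqxx in yn0.
have -> : lorentz y z ^+ 2 = (lnorm y * lnorm z * cosh theta) ^+ 2.
  by case: yz => ->; rewrite ?sqrrN.
rewrite !exprMn /lnorm y1 !sqr_sqrtr ?normr_ge0// normrN normr1 mul1r.
by rewrite ltr0_norm.
Qed.

(** Here [U], [V] are the derivatives of u and v, [k] is x_1', [y] is x_n, and [S], [C] are sinh^2
    and cosh^2 of the angle. With p = V/U, F = c k and G = c^2 + y^2 the hypothesis reads A p^2 + 2
    F C p + C = 0, where A = F^2 + G S. Completing the square after multiplying by 4 A gives the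
    conclusion, which explains the factor in the proof. *)
Lemma slope_spacelike (R : realType) (c k y S C U V : R) :
  U != 0 -> C = 1 + S ->
  (U + V * (c * k)) ^+ 2
    = - (U * U + 2 * (U * V) * (c * k) + V * V * (c ^+ 2 + y ^+ 2)) * S ->
  (V / U * (2 * S * (y ^+ 2 + c ^+ 2) + 2 * c ^+ 2 * k ^+ 2) - - 2 * c * C * k)
    ^+ 2
  = 4 * S * C * (c ^+ 2 * (k ^+ 2 - 1) - y ^+ 2).
Proof.
move=> U0 -> UV; apply/eqP; rewrite -subr_eq0; apply/eqP.
rewrite [LHS](_ : _ = 4 * (S * (y ^+ 2 + c ^+ 2) + c ^+ 2 * k ^+ 2)
  * ((U + V * (c * k)) ^+ 2
    + (U * U + 2 * (U * V) * (c * k) + V * V * (c ^+ 2 + y ^+ 2)) * S)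
  / U ^+ 2).
  by rewrite UV; field.
by field.
Qed.

(** The same completion of the square for A p^2 + 2 F S p - S = 0, where now A = F^2 + G C. *)
Lemma slope_timelike (R : realType) (c k y S C U V : R) :
  U != 0 -> C = 1 + S ->
  (- U + V * (c * k)) ^+ 2
    = - (- (U * U) + 2 * (U * V) * (c * k) + V * V * (c ^+ 2 + y ^+ 2)) * C ->
  (V / U * (2 * C * (y ^+ 2 + c ^+ 2) + 2 * c ^+ 2 * k ^+ 2) - - 2 * c * S * k)
    ^+ 2
  = 4 * S * C * (y ^+ 2 + c ^+ 2 * (k ^+ 2 + 1)).
Proof.
move=> U0 -> UV; apply/eqP; rewrite -subr_eq0; apply/eqP.
rewrite [LHS](_ : _ = 4 * ((1 + S) * (y ^+ 2 + c ^+ 2) + c ^+ 2 * k ^+ 2)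
  * ((- U + V * (c * k)) ^+ 2
    + (- (U * U) + 2 * (U * V) * (c * k) + V * V * (c ^+ 2 + y ^+ 2)) * (1 + S))
  / U ^+ 2).
  by rewrite UV; field.
by field.
Qed.

(** * Regularity of the profile functions and the partial derivatives of [H2] *)

(** The index n-1 is left out because the profile holds 0 there and carries no information on that
    function. *)
Lemma derivable_profile (R : realType) (n : nat) (I : set R) (x : nat -> R -> R)
    u j : smooth_on I (profile n x) -> I u -> (0 < j <= n)%N -> j != n.-1 ->
  derivable (x j) u 1.
Proof.
move=> px Iu; case: j => // j /= jn jn1.
have /derivable_mxP/(_ ord0 (Ordinal jn)) := px 0%N u Iu.
have -> // : (fun s => profile n x s ord0 (Ordinal jn)) = x j.+1.
by apply/funext => s; rewrite mxE/= (negbTE jn1).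
Qed.

Lemma derive1_profile (R : realType) (n : nat) (I : set R) (x : nat -> R -> R)
    u : smooth_on I (profile n x) -> I u ->
  derive1 (profile n x) u = dprofile n x u.
Proof.
move=> px Iu; apply: is_derive_derive1; apply: is_derive_row => j.
rewrite mxE; have -> : (fun s => profile n x s 0 j) =
    if j.+1 == n.-1 then fun=> 0 else x j.+1.
  by apply/funext => s; rewrite mxE; case: ifP.
case: ifPn => [_|jn]; first exact: is_derive_cst.
apply: derivable_is_derive.
by apply: (derivable_profile px) => //=; exact: ltn_ord.
Qed.

Lemma derivable_derive1_profile (R : realType) (n : nat) (I : set R)
    (x : nat -> R -> R) u :
  (3 <= n)%N -> open I -> smooth_on I (profile n x) -> I u ->
  derivable (derive1 (x 1%N)) u 1.
Proof.
move=> n3 oI px Iu; have n0 : (0 < n)%N by lia.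
have /derivable_mxP/(_ ord0 (Ordinal n0)) := px 1%N u Iu.
apply: near_eq_derivable; apply: filterS (open_nbhs_nbhs (conj oI Iu)) => s Is.
rewrite derive1n1 (derive1_profile px)// mxE/= ifN//; lia.
Qed.

Lemma partial_uH2 (R : realType) (n : nat) (I : set R) (x : nat -> R -> R)
    c u v : (3 <= n)%N -> smooth_on I (profile n x) -> I u ->
  partial_u (H2 n c x) u v = H2u n x u v.
Proof.
move=> n3 px Iu; apply: is_derive_derive1.
have dx j := @derivable_profile R n I x u j px Iu.
have := @is_derive_H2 R n c x id (cst v) u 1 0 n3 dx
  (is_derive_id _ _) (is_derive_cst _ _ _).
by rewrite scale1r scale0r addr0.
Qed.

Lemma partial_vH2 (R : realType) (n : nat) (I : set R) (x : nat -> R -> R)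
    c u v : (3 <= n)%N -> smooth_on I (profile n x) -> I u ->
  partial_v (H2 n c x) u v = H2v n c x u v.
Proof.
move=> n3 px Iu; apply: is_derive_derive1.
have dx j := @derivable_profile R n I x u j px Iu.
have := @is_derive_H2 R n c x (cst u) id v 0 1 n3 dx
  (is_derive_cst _ _ _) (is_derive_id _ _).
by rewrite scale1r scale0r add0r.
Qed.

(** * Reparametrization of the loxodrome by [u] and integration of its slope *)

Theorem theorem4p2 (R : realType) (n : nat) (n_ge3 : (3 <= n)%N)
    (I : set R) (I_itv : open_interval I)
    (x : nat -> R -> R) (eps : R) (x_profile : type2_profile n I x eps)
    (c : R) (c_gt0 : 0 < c)
    (M2_timelike : timelike_surface I (@H2 R n c x))
    (T : set R) (T_itv : open_interval T)
    (u v : R -> R) (phi0 : R) (phi0_gt0 : 0 < phi0)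
    (alpha2_lox : timelike_loxodrome I T (@H2 R n c x) u v phi0)
    (du_neq0 : forall t, T t -> derive1 u t != 0) :
  exists tau w : R -> R,
    [/\ open_interval (u @` T),
        (* u is an admissible parameter, with inverse tau *)
        forall t, T t -> tau (u t) = t,
        smooth_on (u @` T) tau /\
          smooth_on (u @` T) w,
        (* in this parameter, the curve is s |-> H2 s (w s) *)
        forall s, (u @` T) s ->
          H2 n c x (u (tau s)) (v (tau s)) = H2 n c x s (w s) &
        (spacelike_meridians I (@H2 R n c x) ->
           given_by_integral (u @` T) (integrand_spacelike n c x phi0) w) /\
        (timelike_meridians I (@H2 R n c x) ->
           given_by_integral (u @` T) (integrand_timelike n c x phi0) w)].
Proof.
have [_ oI _] := I_itv; have [px eps1 arc] := x_profile.
have [[su sv] TI _ _ ang] := alpha2_lox.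
have [[t0 Tt0] _ _] := T_itv.
have [tau [Jitv tauK stau dtau]] := smooth_inverse T_itv su du_neq0.
have [_ oJ iJ] := Jitv.
have tauT s : (u @` T) s -> T (tau s) by move=> [t Tt <-]; rewrite tauK.
have utau s : (u @` T) s -> u (tau s) = s by move=> [t Tt <-]; rewrite tauK.
have JI s : (u @` T) s -> I s by move=> [t Tt <-]; exact: TI.
pose w s := v (tau s).
have sw : smooth_on (u @` T) w := smooth_on_comp oJ tauT stau sv.
have dw s : (u @` T) s -> derivable w s 1 by move=> Js; exact: sw 0%N s Js.
have cw' s : (u @` T) s -> {for s, continuous (derive1 w)}.
  move=> Js; apply: derivable1_continuous; exact: sw 1%N s Js.
(* By the chain rule the slope dv/du is the quotient V/U of the slope lemmas. *)
have w'E s : (u @` T) s ->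
    derive1 w s = derive1 v (tau s) / derive1 u (tau s).
  move=> Js; apply: is_derive_derive1.
  have dv := derivable_is_derive (smooth_on_derivable sv (tauT s Js)).
  exact: (is_derive1_comp dv (dtau s Js)).
have cx1 s : (u @` T) s -> {for s, continuous (derive1 (x 1%N))}.
  by move=> Js; apply: derivable1_continuous;
    exact: (derivable_derive1_profile n_ge3 oI px (JI s Js)).
have cxn s : (u @` T) s -> {for s, continuous (x n)}.
  move=> Js; apply: derivable1_continuous.
  by apply: (derivable_profile px (JI s Js)); lia.
have EFG s b : I s -> [/\ lorentz (H2u n x s b) (H2u n x s b) = eps,
    lorentz (H2u n x s b) (H2v n c x s b) = c * derive1 (x 1%N) s &
    lorentz (H2v n c x s b) (H2v n c x s b) = c ^+ 2 + x n s ^+ 2].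
  move=> Is; have [-> -> ->] := first_fundamental_form c x s b n_ge3.
  by rewrite -(derive1_profile px Is) arc.
(* The vector [a] is the velocity of the loxodrome, U H_u + V H_v; only its products with the
   meridian tangent and with itself matter later. *)
have angle s (U := derive1 u (tau s)) (V := derive1 v (tau s)) : (u @` T) s ->
  exists2 a : 'rV[R]_n, lorentz_angle (H2u n x s (w s)) a phi0 &
    lorentz (H2u n x s (w s)) a = U * eps + V * (c * derive1 (x 1%N) s) /\
    lorentz a a = U * U * eps + 2 * (U * V) * (c * derive1 (x 1%N) s)
                  + V * V * (c ^+ 2 + x n s ^+ 2).
  move=> Js; have Ts := tauT s Js; have Is := JI s Js.
  have [E F G] := EFG s (w s) Is.
  have := ang _ Ts; rewrite (partial_uH2 _ _ n_ge3 px)//; last by rewrite utau.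
  have du := derivable_is_derive (smooth_on_derivable su Ts).
  have dv := derivable_is_derive (smooth_on_derivable sv Ts).
  have dx j := @derivable_profile R n I x (u (tau s)) j px (TI _ Ts).
  rewrite (is_derive_derive1 (is_derive_H2 c n_ge3 dx du dv)) utau// -/(w s).
  rewrite -/U -/V => angs; eexists; first exact: angs.
  rewrite lorentzC !lorentzDZl [lorentz _ (U *: _ + _)]lorentzC.
  rewrite [lorentz (H2v _ _ _ _ _) (U *: _ + _)]lorentzC !lorentzDZl.
  by rewrite [lorentz (H2v _ _ _ _ _) (H2u _ _ _ _)]lorentzC E F G; split; ring.
exists tau, w; split=> //; first by move=> s Js; rewrite utau.
(* A point of the profile interval at which the causal character of the meridians will determine
   [eps]. *)
have It0 : I (u t0) := TI t0 Tt0.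
have sh := sinh_gt0 phi0_gt0; have chE := cosh2E phi0.
have sh2 : 0 < sinh phi0 ^+ 2 by rewrite exprn_gt0.
have ch2 : 0 < cosh phi0 ^+ 2 by rewrite exprn_gt0// cosh_gt0.
have dblE : sinh (2 * phi0) ^+ 2 = 4 * sinh phi0 ^+ 2 * cosh phi0 ^+ 2.
  by rewrite sinh_double; ring.
have c2 : 0 < c ^+ 2 by rewrite exprn_gt0.
have dbl0 : 0 < sinh (2 * phi0) ^+ 2.
  by rewrite exprn_gt0// sinh_gt0//; lra.
have cX (f : R -> R) s : {for s, continuous f} ->
    {for s, continuous (fun s => f s ^+ 2)}.
  by move=> cf; exact: (continuousM cf cf).
(* The common shape of the denominators of the two integrands. *)
have cB (k l m : R) s : (u @` T) s -> {for s, continuous (fun s =>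
    k * (x n s ^+ 2 + l) + m * derive1 (x 1%N) s ^+ 2)}.
  move=> Js; apply: continuousD; apply: continuousM; try exact: cvg_cst.
    apply: continuousD; last exact: cvg_cst.
    exact: cX (cxn s Js).
  exact: cX (cx1 s Js).
split=> mer.
- have epsE : eps = 1.
    case: eps1 => // e; have [E _ _] := EFG (u t0) 0 It0.
    have := mer 0 (u t0) It0; rewrite -/(partial_u (H2 n c x) (u t0) 0).
    rewrite (partial_uH2 _ _ n_ge3 px)// => -[|H0]; first by rewrite E e; lra.
    (* A spacelike vector may be zero, but with zero coefficients bilinearity gives the zero vector
       product 0, against [eps = -1]. *)
    have := lorentzDZl 0 0 (0 : 'rV[R]_n) 0 0.
    by move: E; rewrite e H0 => E; rewrite !scale0r addr0 E; lra.
  apply: (given_by_integral_quadratic iJ dw cw'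
    (a := fun s => - 2 * c * cosh phi0 ^+ 2 * derive1 (x 1%N) s)
    (b := fun s => 2 * sinh phi0 ^+ 2 * (x n s ^+ 2 + c ^+ 2)
                   + 2 * c ^+ 2 * derive1 (x 1%N) s ^+ 2)
    (d := fun s => sinh (2 * phi0) ^+ 2
                   * (c ^+ 2 * (derive1 (x 1%N) s ^+ 2 - 1) - x n s ^+ 2))).
  + by move=> s Js; apply: continuousM; [exact: cvg_cst|exact: cx1].
  + exact: cB.
  + move=> s Js; have := sqr_ge0 (x n s); have := sqr_ge0 (derive1 (x 1%N) s).
    nra.
  + move=> s Js; have Is := JI s Js.
    (* For [eps = 1] the inequality E G - F^2 < 0 says exactly that the second factor of the
       radicand is positive; 0 is an arbitrary choice of v. *)
    have := M2_timelike s 0 Is.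
    rewrite /= (partial_uH2 _ _ n_ge3 px)// (partial_vH2 _ _ n_ge3 px)//.
    have [-> -> ->] := EFG s 0 Is; rewrite epsE => neg.
    apply: (mulr_gt0 dbl0).
    move: neg; rewrite mul1r exprMn subr_lt0 mulrBr mulr1; lra.
  + by [].
  + move=> s Js; have [a an [yz zz]] := angle s Js.
    have [E _ _] := EFG s (w s) (JI s Js).
    rewrite epsE in E yz zz.
    have := lorentz_angle_spacelike E an; rewrite yz zz !mulr1 => q.
    rewrite w'E// dblE; apply: slope_spacelike => //.
    exact: du_neq0 (tauT s Js).
- have epsE : eps = -1.
    case: eps1 => // e; have [E _ _] := EFG (u t0) 0 It0.
    have := mer 0 (u t0) It0; rewrite -/(partial_u (H2 n c x) (u t0) 0).
    by rewrite (partial_uH2 _ _ n_ge3 px)// /timelike E e; lra.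
  apply: (given_by_integral_quadratic iJ dw cw'
    (a := fun s => - 2 * c * sinh phi0 ^+ 2 * derive1 (x 1%N) s)
    (b := fun s => 2 * cosh phi0 ^+ 2 * (x n s ^+ 2 + c ^+ 2)
                   + 2 * c ^+ 2 * derive1 (x 1%N) s ^+ 2)
    (d := fun s => sinh (2 * phi0) ^+ 2
                   * (x n s ^+ 2 + c ^+ 2 * (derive1 (x 1%N) s ^+ 2 + 1)))).
  + by move=> s Js; apply: continuousM; [exact: cvg_cst|exact: cx1].
  + exact: cB.
  + move=> s Js; have := sqr_ge0 (x n s); have := sqr_ge0 (derive1 (x 1%N) s).
    nra.
  (* For [eps = -1] the second factor is at least c^2, hence positive. *)
  + move=> s Js; apply: (mulr_gt0 dbl0).
    have := sqr_ge0 (x n s); have := sqr_ge0 (derive1 (x 1%N) s); nra.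
  + by [].
  + move=> s Js; have [a an [yz zz]] := angle s Js.
    have [E _ _] := EFG s (w s) (JI s Js).
    rewrite epsE in E yz zz.
    have := lorentz_angle_timelike E an; rewrite yz zz !mulrN1 => q.
    rewrite w'E// dblE; apply: slope_timelike => //.
    exact: du_neq0 (tauT s Js).
Qed.
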